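(* Let $(M,F)$ be a connected complex Kropina space, $F=\alpha^2/|\beta|$, $|\beta|\ne0$, such that $$\Big(\bar\beta\, l_{\bar r}\frac{\partial b^{\bar r}}{\partial z^j}+\beta\,\frac{\partial b_{\bar r}}{\partial z^j}\bar\eta^r\Big)\eta^j=0 .$$ Then $(M,F)$ is generalized Berwald.
   Context: Let $M$ be a complex manifold of dimension $n$, $T'M$ its holomorphic tangent bundle with local coordinates $(z^k,\eta^k)$. Let $a_{i\bar j}(z)dz^i\otimes d\bar z^j$ be a Hermitian metric on $M$ (a purely Hermitian metric) with inverse matrix $(a^{\bar ji})$ and $b=b_i(z)dz^i$ a differential $(1,0)$-form; set $\alpha(z,\eta)=\sqrt{a_{i\bar j}(z)\eta^i\bar\eta^j}$, $\beta(z,\eta)=b_i(z)\eta^i$, $b_{\bar j}=\overline{b_j}$, $b^i=a^{\bar ji}b_{\bar j}$, $b^{\bar\imath}=\bar b^i=\overline{b^i}$, $l_i=a_{i\bar j}\bar\eta^j$, $l_{\bar r}=\overline{l_r}=a_{i\bar r}\eta^i$. A complex Kropina space is $(M,F)$ with $F=\alpha^2/|\beta|$, considered on the open set of $(z,\eta)\in T'M$ with $\beta(z,\eta)\neq0$; all conditions and identities are on this set. $L:=F^2$ and $g_{i\bar j}:=\partial^2L/\partial\eta^i\partial\bar\eta^j$, a positive definite Hermitian matrix with inverse $(g^{\bar ji})$. Notation: $\dot\partial_k=\partial/\partial\eta^k$; summation convention. $N^i_j:=g^{\bar mi}\frac{\partial g_{l\bar m}}{\partial z^j}\eta^l$, spray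 coefficients $G^i:=\tfrac12N^i_j\eta^j$, Berwald coefficients $\overset{B}{L}{}^i_{jk}:=\dot\partial_k\dot\partial_jG^i$. The space is generalized Berwald if the $\overset{B}{L}{}^i_{jk}$ depend only on $z$. *)

(* Defs.v *)
From HB Require Import structures.
From mathcomp Require Import all_boot all_order all_algebra.
From mathcomp Require Import sesquilinear spectral complex.
From mathcomp Require Import boolp classical_sets reals topology normedtype derive.

Set Implicit Arguments.
Unset Strict Implicit.
Unset Printing Implicit Defensive.

Import Order.TTheory GRing.Theory Num.Theory numFieldNormedType.Exports.
Local Open Scope ring_scope.
Local Open Scope classical_set_scope.
Local Open Scope sesquilinear_scope.

(* [complex R] repackaged so that it, and row vectors over it, inherit the
   norm topology of a [numFieldType].  Consequently [differentiable] between
   spaces of row vectors over [Cplx R] means complex-differentiable. *)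
Definition Cplx (R : realType) : numClosedFieldType := complex R.

Section Wirtinger.
Variables (R : realType) (n : nat).
Implicit Types (f : 'rV[Cplx R]_n -> Cplx R) (z v : 'rV[Cplx R]_n).

Definition re_line f z v (t : R) : R := complex.Re (f (z + (t%:C)%C *: v)).
Definition im_line f z v (t : R) : R := complex.Im (f (z + (t%:C)%C *: v)).

(* Derivative of the complex-valued [f] at [z] in the direction [v], with
   respect to a real parameter; it is total, and meaningful when
   [real_derivable f z v]. *)
Definition real_derivable f z v : Prop :=
  derivable (re_line f z v) 0 1 /\ derivable (im_line f z v) 0 1.

Definition real_derive f v z : Cplx R :=
  ((re_line f z v)^`() 0 +i* (im_line f z v)^`() 0)%C.

(* d/dz^k = (d/dx^k - i d/dy^k)/2 and d/d(bar z^k) = (d/dx^k + i d/dy^k)/2 *)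
Definition dz (k : 'I_n) f z : Cplx R :=
  (real_derive f 'e_k z - 'i * real_derive f ('i *: 'e_k) z) / 2.

Definition dzbar (k : 'I_n) f z : Cplx R :=
  (real_derive f 'e_k z + 'i * real_derive f ('i *: 'e_k) z) / 2.

(* Real differentiability class C^m on an open set [U]. *)
Fixpoint Ck (m : nat) (U : set 'rV[Cplx R]_n) f : Prop :=
  (forall z, U z -> {for z, continuous f}) /\
  if m is m'.+1 then
    forall v, (forall z, U z -> real_derivable f z v) /\ Ck m' U (real_derive f v)
  else True.

Definition smooth_on (U : set 'rV[Cplx R]_n) f : Prop := forall m, Ck m U f.

End Wirtinger.

Definition posdefmx (R : realType) n (A : 'M[Cplx R]_n) : Prop :=
  A \is hermsymmx /\
  forall v : 'rV[Cplx R]_n, v != 0 -> 0 < (v *m A *m v ^t*) 0 0.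

(* The functions [chart_map] and [chart_inv] are total; their values outside
   of [chart_dom], resp. of its image, are irrelevant. *)
Record chart (R : realType) (n : nat) (M : topologicalType) := Chart {
  chart_dom : set M;
  chart_map :> M -> 'rV[Cplx R]_n;
  chart_inv : 'rV[Cplx R]_n -> M;
  chart_dom_open : open chart_dom;
  chart_im_open : open (chart_map @` chart_dom);
  chart_mapK : forall p, chart_dom p -> chart_inv (chart_map p) = p;
  chart_map_cont : {within chart_dom, continuous chart_map};
  chart_inv_cont : {within chart_map @` chart_dom, continuous chart_inv}
}.

Definition chart_im (R : realType) n (M : topologicalType) (c : chart R n M) :
  set 'rV[Cplx R]_n := c @` chart_dom c.

(* Coordinates of [d] as functions of those of [c], and the matrix whose
   entry in row i and column k is the derivative of the k-th coordinate of
   [d] with respect to the i-th coordinate of [c], at the point [p]. *)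
Definition transition (R : realType) n (M : topologicalType) (c d : chart R n M) :
  'rV[Cplx R]_n -> 'rV[Cplx R]_n := fun z => d (chart_inv c z).

Definition transition_jac (R : realType) n (M : topologicalType)
    (c d : chart R n M) (p : M) : 'M[Cplx R]_n :=
  jacobian (transition c d) (c p).

Record complexManifold (R : realType) (n : nat) := ComplexManifold {
  carrier :> topologicalType;
  atlas : set (chart R n carrier);
  carrier_hausdorff : hausdorff_space carrier;
  carrier_second_countable : @second_countable carrier;
  atlas_cover : forall p, exists2 c, atlas c & chart_dom c p;
  atlas_holomorphic : forall c d, atlas c -> atlas d ->
    forall p, chart_dom c p -> chart_dom d p ->
      differentiable (transition c d) (c p)
}.

(* Tensor fields are given by their components in the charts of the atlas,
   subject to the transformation laws
     a_{i jbar} = a'_{k lbar} (dz'^k/dz^i) conj(dz'^l/dz^j),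
     b_i = b'_k (dz'^k/dz^i). *)
Record hermitianMetric (R : realType) (n : nat) (M : complexManifold R n) :=
  HermitianMetric {
  metric_comp :> chart R n M -> 'rV[Cplx R]_n -> 'M[Cplx R]_n;
  metric_smooth : forall c, atlas c -> forall i j,
    smooth_on (chart_im c) (fun z => metric_comp c z i j);
  metric_posdef : forall c, atlas c -> forall z, chart_im c z ->
    posdefmx (metric_comp c z);
  metric_change : forall c d, atlas c -> atlas d ->
    forall p, chart_dom c p -> chart_dom d p ->
      metric_comp c (c p) =
        transition_jac c d p *m metric_comp d (d p) *m (transition_jac c d p) ^t*
}.

Record oneForm (R : realType) (n : nat) (M : complexManifold R n) := OneForm {
  form_comp :> chart R n M -> 'rV[Cplx R]_n -> 'rV[Cplx R]_n;
  form_smooth : forall c, atlas c -> forall i,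
    smooth_on (chart_im c) (fun z => form_comp c z 0 i);
  form_change : forall c d, atlas c -> atlas d ->
    forall p, chart_dom c p -> chart_dom d p ->
      form_comp c (c p) = form_comp d (d p) *m (transition_jac c d p)^T
}.

(* Quantities attached to a complex Finsler function [F z eta] written in
   local coordinates. *)
Section Finsler.
Variables (R : realType) (n : nat).
Variable F : 'rV[Cplx R]_n -> 'rV[Cplx R]_n -> Cplx R.

Definition fundamental_tensor (z eta : 'rV[Cplx R]_n) : 'M[Cplx R]_n :=
  \matrix_(i, j) dz i (dzbar j (fun eta' => F z eta' ^+ 2)) eta.

(* The inverse g^{mbar i} is the entry in row m and column i of [invmx g]. *)
Definition CF_connection (i j : 'I_n) (z eta : 'rV[Cplx R]_n) : Cplx R :=
  \sum_m \sum_l invmx (fundamental_tensor z eta) m i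
                * dz j (fun z' => fundamental_tensor z' eta l m) z * eta 0 l.

Definition spray (i : 'I_n) (z eta : 'rV[Cplx R]_n) : Cplx R :=
  2^-1 * \sum_j CF_connection i j z eta * eta 0 j.

Definition berwald_coef (i j k : 'I_n) (z eta : 'rV[Cplx R]_n) : Cplx R :=
  dz k (dz j (spray i z)) eta.

End Finsler.

Section KropinaLocal.
Variables (R : realType) (n : nat).
Variables (a : 'rV[Cplx R]_n -> 'M[Cplx R]_n) (b : 'rV[Cplx R]_n -> 'rV[Cplx R]_n).
Implicit Types z eta : 'rV[Cplx R]_n.

Definition alpha z eta : Cplx R :=
  sqrtC (\sum_i \sum_j a z i j * eta 0 i * (eta 0 j)^*).

Definition beta z eta : Cplx R := \sum_i b z 0 i * eta 0 i.

Definition kropina z eta : Cplx R := alpha z eta ^+ 2 / `|beta z eta|.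

Definition b_up (i : 'I_n) z : Cplx R :=
  \sum_j invmx (a z) j i * (b z 0 j)^*.

Definition l_low (i : 'I_n) z eta : Cplx R :=
  \sum_j a z i j * (eta 0 j)^*.

Definition kropina_expr z eta : Cplx R :=
  \sum_j ((beta z eta)^* *
            (\sum_r (l_low r z eta)^* * dz j (fun z' => (b_up r z')^*) z)
          + beta z eta *
            (\sum_r dz j (fun z' => (b z' 0 r)^*) z * (eta 0 r)^*)) * eta 0 j.

End KropinaLocal.

Record kropinaSpace (R : realType) (n : nat) (M : complexManifold R n) :=
  KropinaSpace {
  kmetric : hermitianMetric M;
  kform : oneForm M;
  kropina_posdef : forall c, atlas c -> forall z, chart_im c z ->
    forall eta, beta (kform c) z eta != 0 ->
      posdefmx (fundamental_tensor (kropina (kmetric c) (kform c)) z eta)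
}.

Definition generalized_berwald (R : realType) n (M : complexManifold R n)
    (K : kropinaSpace M) : Prop :=
  forall c, atlas c ->
  exists Gamma : 'I_n -> 'I_n -> 'I_n -> 'rV[Cplx R]_n -> Cplx R,
    forall z, chart_im c z -> forall eta, beta (kform K c) z eta != 0 ->
    forall i j k,
      berwald_coef (kropina (kmetric K c) (kform K c)) i j k z eta = Gamma i j k z.

(* Main.v *)
Require Import Defs.
From mathcomp Require Import all_boot all_order all_algebra.
From mathcomp Require Import boolp classical_sets reals topology normedtype.
From mathcomp Require Import sesquilinear spectral complex functions derive ring.

(* Write D = eta^j d/dz^j and let X^i = a^{mbar i} D l_mbar be twice the spray of
   the Hermitian metric a.  Since l_rbar b^rbar = beta, the hypothesis reads
     bar beta (D beta - b_i X^i) + beta (D b_rbar) bar eta^r = 0,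
   where only bar beta and bar eta^r are not holomorphic in eta.  Its coefficient
   of bar eta^m gives D b_mbar = v b_mbar with v = (b_i X^i - D beta) / beta, and
   this is exactly what makes X solve g_{i mbar} X^i = D (dL/d bar eta^m), the
   equation of twice the spray of F.  So F has the spray of a, whose components
   are quadratic in eta with coefficients depending on z only. *)

Set Implicit Arguments.
Unset Strict Implicit.
Unset Printing Implicit Defensive.

Import Order.TTheory GRing.Theory Num.Theory numFieldNormedType.Exports.
Local Open Scope ring_scope.
Local Open Scope classical_set_scope.

(** * Derivatives of complex-valued functions of a real parameter *)

(** [Cplx R] is normed over itself and the parameter is real, so the derivative is taken on real and
    imaginary parts separately, as in [real_derive]. Using [is_derive] keeps existence and value
    together. *)
Definition path_derive (R : realType) (h : R -> Cplx R) (d : Cplx R) : Prop :=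
  is_derive (0 : R) 1 (fun t => complex.Re (h t)) (complex.Re d) /\
  is_derive (0 : R) 1 (fun t => complex.Im (h t)) (complex.Im d).

Section PathDerive.
Variable R : realType.
Implicit Types (h g : R -> Cplx R) (c d e : Cplx R).

Let ReD (x y : Cplx R) : complex.Re (x + y) = complex.Re x + complex.Re y.
Proof. by case: x; case: y. Qed.
Let ImD (x y : Cplx R) : complex.Im (x + y) = complex.Im x + complex.Im y.
Proof. by case: x; case: y. Qed.
Let ReM (x y : Cplx R) : complex.Re (x * y) =
  complex.Re x * complex.Re y - complex.Im x * complex.Im y.
Proof. by case: x; case: y. Qed.
Let ImM (x y : Cplx R) : complex.Im (x * y) =
  complex.Re x * complex.Im y + complex.Im x * complex.Re y.
Proof. by case: x; case: y. Qed.
Let ReJ (x : Cplx R) : complex.Re x^* = complex.Re x.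
Proof. by case: x. Qed.
Let ImJ (x : Cplx R) : complex.Im x^* = - complex.Im x.
Proof. by case: x. Qed.

Lemma path_derive_cst c : path_derive (fun=> c) 0.
Proof. by split; apply: is_derive_cst. Qed.

Lemma path_derive_line c d : path_derive (fun t => c + t%:C%C * d) d.
Proof.
split.
- rewrite (_ : (fun t => _) = cst (complex.Re c) + complex.Re d \*: id).
    apply: (is_derive_eq (is_deriveD (is_derive_cst _ _ _)
      (is_deriveZ _ (is_derive_id _ _)))).
    by rewrite add0r /GRing.scale /= mulr1.
  by apply/funext => t; rewrite ReD ReM /= mul0r subr0 mulrC.
- rewrite (_ : (fun t => _) = cst (complex.Im c) + complex.Im d \*: id).
    apply: (is_derive_eq (is_deriveD (is_derive_cst _ _ _)
      (is_deriveZ _ (is_derive_id _ _)))).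
    by rewrite add0r /GRing.scale /= mulr1.
  by apply/funext => t; rewrite ImD ImM /= mul0r addr0 mulrC.
Qed.

Lemma path_deriveD h g d e :
  path_derive h d -> path_derive g e -> path_derive (fun t => h t + g t) (d + e).
Proof.
move=> [h1 h2] [g1 g2]; split.
- rewrite ReD (_ : (fun t => _) =
      (fun t => complex.Re (h t)) + (fun t => complex.Re (g t))).
    exact: is_deriveD.
  by apply/funext => t; rewrite ReD.
- rewrite ImD (_ : (fun t => _) =
      (fun t => complex.Im (h t)) + (fun t => complex.Im (g t))).
    exact: is_deriveD.
  by apply/funext => t; rewrite ImD.
Qed.

Lemma path_deriveM h g d e :
  path_derive h d -> path_derive g e ->
  path_derive (fun t => h t * g t) (d * g 0 + h 0 * e).
Proof.
move=> [h1 h2] [g1 g2]; split.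
- rewrite (_ : (fun t => _) =
      (fun t => complex.Re (h t)) * (fun t => complex.Re (g t))
      - (fun t => complex.Im (h t)) * (fun t => complex.Im (g t))).
    apply: (is_derive_eq (is_deriveB (is_deriveM h1 g1) (is_deriveM h2 g2))).
    by rewrite ReD !ReM /GRing.scale /=; ring.
  by apply/funext => t; rewrite ReM.
- rewrite (_ : (fun t => _) =
      (fun t => complex.Re (h t)) * (fun t => complex.Im (g t))
      + (fun t => complex.Im (h t)) * (fun t => complex.Re (g t))).
    apply: (is_derive_eq (is_deriveD (is_deriveM h1 g2) (is_deriveM h2 g1))).
    by rewrite ImD !ImM /GRing.scale /=; ring.
  by apply/funext => t; rewrite ImM.
Qed.

Lemma path_deriveJ h d : path_derive h d -> path_derive (fun t => (h t)^*) d^*.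
Proof.
move=> [h1 h2]; split.
- rewrite ReJ (_ : (fun t => _) = (fun t => complex.Re (h t))) //.
  by apply/funext => t; rewrite ReJ.
- rewrite ImJ (_ : (fun t => _) = - (fun t => complex.Im (h t))).
    exact: is_deriveN.
  by apply/funext => t; rewrite ImJ.
Qed.

Lemma path_derive_real (r : R -> R) (r' : R) :
  is_derive (0 : R) 1 r r' -> path_derive (fun t => (r t)%:C%C) r'%:C%C.
Proof. by move=> ?; split => //=; exact: is_derive_cst. Qed.

(** Writing 1/h as the conjugate of h divided by |h|^2 reduces the claim to the inverse of the real
    function [N]. *)
Lemma path_deriveV h d :
  h 0 != 0 -> path_derive h d ->
  path_derive (fun t => (h t)^-1) (- d / h 0 ^+ 2).
Proof.
move=> h0 hd.
have real_norm (x : Cplx R) : (complex.Re (x * x^*))%:C%C = x * x^*.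
  by rewrite RRe_real // -normCK realX // normr_real.
have real_tr :
    (complex.Re (d * (h 0)^* + h 0 * d^*))%:C%C = d * (h 0)^* + h 0 * d^*.
  rewrite RRe_real // CrealE rmorphD !rmorphM /= !conjCK addrC.
  by rewrite [(h 0)^* * d]mulrC [d^* * _]mulrC.
pose N (t : R) : R := complex.Re (h t * (h t)^*).
have N0 : N 0 != 0.
  have : (N 0)%:C%C != 0 :> Cplx R by rewrite real_norm mulf_neq0 // conjC_eq0.
  by apply: contraNN => /eqP ->.
have [dN _] := path_deriveM hd (path_deriveJ hd).
have dV : is_derive (0 : R) 1 (fun t => (N t)^-1)
    (- (N 0) ^- 2 * complex.Re (d * (h 0)^* + h 0 * d^*)).
  have exN := @ex_derive _ _ _ _ _ _ _ dN.
  apply: DeriveDef; first exact: derivableV.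
  by rewrite (@deriveV _ _ N) // (@derive_val _ _ _ _ _ _ _ dN).
have := path_deriveM (path_deriveJ hd) (path_derive_real dV).
rewrite (_ : (fun t => _) = (fun t => (h t)^-1)); last first.
  apply/funext => t; rewrite fmorphV /= real_norm.
  (* The identity also holds at zeros of [h], where both sides are 0, so it is an equality of
     functions and not only of germs. *)
  have [->|ht] := eqVneq (h t) 0; first by rewrite conjC0 mul0r invr0.
  by rewrite invfM mulrCA mulfV ?mulr1 // conjC_eq0.
congr (path_derive _ _).
rewrite rmorphM rmorphN /= !fmorphV rmorphXn /= real_norm real_tr.
by field; rewrite h0 conjC_eq0.
Qed.

End PathDerive.

Lemma path_derive_near (R : realType) (h g : R -> Cplx R) (d : Cplx R) :
  (\forall t \near (0 : R), h t = g t) -> path_derive h d -> path_derive g d.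
Proof.
move=> hg [h1 h2]; split.
- by apply: near_eq_is_derive h1; near=> t; rewrite (near hg t).
- by apply: near_eq_is_derive h2; near=> t; rewrite (near hg t).
Unshelve. all: by end_near. Qed.

(** Turns an equality valid near z into one valid for small real t along a line, the only place
    where a directional derivative looks. *)
Lemma near_real_line (R : realType) n (z v : 'rV[Cplx R]_n)
    (A : set 'rV[Cplx R]_n) :
  nbhs z A -> \forall t \near (0 : R), A (z + t%:C%C *: v).
Proof.
move=> /nbhs_normP [e /= e0 zA].
(* The norm takes values in [Cplx R], so the estimate is made on real parts. The summand 1 in the
   radius keeps the denominator positive when v = 0. *)
have ee : e = (complex.Re e)%:C%C by rewrite RRe_real // gtr0_real.
have e0' : 0 < complex.Re e by move: e0; rewrite {1}ee ltcR.
have vv : `|v| = (complex.Re `|v|)%:C%C by rewrite RRe_real // normr_real.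
have v0 : 0 <= complex.Re `|v| by have := normr_ge0 v; rewrite {1}vv lecR.
have d0 : 0 < complex.Re e / (complex.Re `|v| + 1).
  by rewrite divr_gt0 // ltr_wpDl.
apply/nbhs_normP; exists (complex.Re e / (complex.Re `|v| + 1)) => //= t.
rewrite /ball_ /= sub0r normrN => td; apply: zA.
rewrite /ball_ /= opprD addNKr normrN normrZ.
have -> : `|t%:C%C : Cplx R| = `|t|%:C%C.
  by rewrite normc_def /= expr0n /= addr0 sqrtr_sqr.
rewrite vv ee -rmorphM ltcR.
apply: le_lt_trans (_ : `|t| * (complex.Re `|v| + 1) < _).
  by rewrite ler_wpM2l // lerDl.
by rewrite -ltr_pdivlMr // ltr_wpDl.
Qed.

(* The real-linear differential of [f] restricted to the k-th coordinate line
   is [h |-> p * h + q * h^*]. *)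
Definition wirtinger (R : realType) n (k : 'I_n) (f : 'rV[Cplx R]_n -> Cplx R)
    (z : 'rV[Cplx R]_n) (p q : Cplx R) : Prop :=
  path_derive (fun t => f (z + t%:C%C *: 'e_k)) (p + q) /\
  path_derive (fun t => f (z + t%:C%C *: ('i *: 'e_k))) ('i * (p - q)).

(** * Rules of Wirtinger calculus *)

Section WirtingerCalculus.
Variables (R : realType) (n : nat) (k : 'I_n).
Implicit Types (f g : 'rV[Cplx R]_n -> Cplx R) (z v : 'rV[Cplx R]_n).
Implicit Types (p q : Cplx R).

Lemma real_deriveE f v z d :
  path_derive (fun t => f (z + t%:C%C *: v)) d -> real_derive f v z = d.
Proof.
move=> [h1 h2]; rewrite /real_derive !derive1E.
rewrite (@derive_val _ _ _ _ _ _ _ h1) (@derive_val _ _ _ _ _ _ _ h2).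
by case: d {h1 h2}.
Qed.

Lemma wirtinger_dz f z p q : wirtinger k f z p q -> dz k f z = p.
Proof.
move=> [h1 h2]; rewrite /dz (real_deriveE h1) (real_deriveE h2).
by rewrite mulrA -expr2 sqrCi; field.
Qed.

Lemma wirtinger_dzbar f z p q : wirtinger k f z p q -> dzbar k f z = q.
Proof.
move=> [h1 h2]; rewrite /dzbar (real_deriveE h1) (real_deriveE h2).
by rewrite mulrA -expr2 sqrCi; field.
Qed.

Lemma wirtinger_real_derivable f z :
  (forall v, real_derivable f z v) -> wirtinger k f z (dz k f z) (dzbar k f z).
Proof.
move=> df.
have path v : path_derive (fun t => f (z + t%:C%C *: v)) (real_derive f v z).
  have [h1 h2] := df v.
  by split; [apply: (DeriveDef h1)|apply: (DeriveDef h2)]; rewrite -derive1E.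
split.
- rewrite (_ : _ + _ = real_derive f 'e_k z); first exact: path.
  rewrite /dz /dzbar; move: (real_derive f 'e_k z) => x.
  by move: (real_derive _ _ _) => y; field.
- rewrite (_ : 'i * _ = real_derive f ('i *: 'e_k) z); first exact: path.
  rewrite /dz /dzbar; move: (real_derive f ('i *: 'e_k) z) => y.
  move: (real_derive _ _ _) => x.
  transitivity (- 'i ^+ 2 * y); first by field.
  by rewrite sqrCi opprK mul1r.
Qed.

Lemma wirtinger_smooth (U : set 'rV[Cplx R]_n) f z :
  smooth_on U f -> U z -> wirtinger k f z (dz k f z) (dzbar k f z).
Proof.
by move=> /(_ 1%N) [_ h] Uz; apply: wirtinger_real_derivable => v; exact: (h v).1.
Qed.

Lemma wirtinger_eq f z p q p' q' :
  wirtinger k f z p q -> p = p' -> q = q' -> wirtinger k f z p' q'.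
Proof. by move=> ? <- <-. Qed.

Lemma wirtinger_near f g z p q :
  (\forall z' \near z, f z' = g z') -> wirtinger k f z p q -> wirtinger k g z p q.
Proof.
move=> fg [h1 h2]; split.
- by apply: path_derive_near h1; exact: (near_real_line 'e_k fg).
- by apply: path_derive_near h2; exact: (near_real_line ('i *: 'e_k) fg).
Qed.

Lemma wirtinger_cst z c : wirtinger k (fun=> c) z 0 0.
Proof.
by split; rewrite ?addr0 ?subr0 ?mulr0; exact: path_derive_cst.
Qed.

Lemma wirtinger_coord (l : 'I_n) z :
  wirtinger k (fun z' => z' 0 l) z (l == k)%:R 0.
Proof.
split.
- rewrite (_ : (fun t => _) = fun t : R => z 0 l + t%:C%C * (l == k)%:R) ?addr0.
    exact: path_derive_line.
  by apply/funext => t; rewrite !mxE eqxx.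
- rewrite (_ : (fun t => _) = fun t : R => z 0 l + t%:C%C * ('i * (l == k)%:R)) ?subr0.
    exact: path_derive_line.
  by apply/funext => t; rewrite !mxE eqxx.
Qed.

Lemma wirtingerD f g z p q p' q' :
  wirtinger k f z p q -> wirtinger k g z p' q' ->
  wirtinger k (fun z' => f z' + g z') z (p + p') (q + q').
Proof.
move=> [f1 f2] [g1 g2]; split.
- by rewrite addrACA; exact: path_deriveD.
- by rewrite opprD addrACA mulrDr; exact: path_deriveD.
Qed.

Lemma wirtingerM f g z p q p' q' :
  wirtinger k f z p q -> wirtinger k g z p' q' ->
  wirtinger k (fun z' => f z' * g z') z (p * g z + f z * p') (q * g z + f z * q').
Proof.
have line0 (v : 'rV[Cplx R]_n) : z + (0 : R)%:C%C *: v = z.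
  by rewrite scale0r addr0.
move=> [f1 f2] [g1 g2]; split.
- by have := path_deriveM f1 g1; rewrite !line0; congr path_derive; ring.
- by have := path_deriveM f2 g2; rewrite !line0; congr path_derive; ring.
Qed.

Lemma wirtingerZ c f z p q :
  wirtinger k f z p q -> wirtinger k (fun z' => c * f z') z (c * p) (c * q).
Proof.
by move=> h; apply: wirtinger_eq (wirtingerM (wirtinger_cst z c) h) _ _;
  rewrite mul0r add0r.
Qed.

Lemma wirtingerN f z p q :
  wirtinger k f z p q -> wirtinger k (fun z' => - f z') z (- p) (- q).
Proof.
move=> /(wirtingerZ (-1)); rewrite !mulN1r.
by rewrite (_ : (fun z' => _) = fun z' => - f z') //; apply/funext => z'; rewrite mulN1r.
Qed.

(** Conjugating p h + q h^* exchanges the roles of the two coefficients. *)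
Lemma wirtingerJ f z p q :
  wirtinger k f z p q -> wirtinger k (fun z' => (f z')^*) z q^* p^*.
Proof.
move=> [f1 f2]; split.
- by have := path_deriveJ f1; rewrite rmorphD addrC.
- have := path_deriveJ f2; congr path_derive.
  by rewrite rmorphM rmorphB /= conjCi; ring.
Qed.

Lemma wirtingerV f z p q : f z != 0 -> wirtinger k f z p q ->
  wirtinger k (fun z' => (f z')^-1) z (- p / f z ^+ 2) (- q / f z ^+ 2).
Proof.
have line0 (v : 'rV[Cplx R]_n) : z + (0 : R)%:C%C *: v = z.
  by rewrite scale0r addr0.
move=> f0 [f1 f2]; split.
- have := @path_deriveV _ _ _ _ f1; rewrite line0 => /(_ f0).
  by congr path_derive; ring.
- have := @path_deriveV _ _ _ _ f2; rewrite line0 => /(_ f0).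
  by congr path_derive; ring.
Qed.

Lemma wirtinger_sum (I : Type) (r : seq I) (P : pred I)
    (f : I -> 'rV[Cplx R]_n -> Cplx R) z (p q : I -> Cplx R) :
  (forall i, wirtinger k (f i) z (p i) (q i)) ->
  wirtinger k (fun z' => \sum_(i <- r | P i) f i z') z
    (\sum_(i <- r | P i) p i) (\sum_(i <- r | P i) q i).
Proof.
move=> h; elim: r => [|i r IH].
  by rewrite (_ : (fun z' => _) = fun=> 0) ?big_nil;
    [exact: wirtinger_cst | apply/funext => z'; rewrite big_nil].
rewrite (_ : (fun z' => _) = fun z' => (if P i then f i z' else 0)
    + \sum_(i <- r | P i) f i z'); last first.
  by apply/funext => z'; rewrite big_cons; case: ifP; rewrite ?add0r.
rewrite !big_cons; case: ifP => _; first exact: wirtingerD.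
by apply: wirtinger_eq (wirtingerD (wirtinger_cst _ _) IH) _ _; rewrite add0r.
Qed.

Lemma wirtinger_coordM (c : Cplx R) (l : 'I_n) z :
  wirtinger k (fun z' => c * z' 0 l) z (c * (l == k)%:R) 0.
Proof.
by apply: wirtinger_eq (wirtingerZ c (wirtinger_coord _ _)) _ _; rewrite ?mulr0.
Qed.

End WirtingerCalculus.

(** * Differentiable and holomorphic functions in one coordinate *)

Section WirtingerDifferentiable.
Variables (R : realType) (n : nat) (k : 'I_n).
Implicit Types (f g : 'rV[Cplx R]_n -> Cplx R) (z : 'rV[Cplx R]_n).

(** Existence without values, for functions whose derivatives need no explicit formula; [wdiffP]
    gives the values back as [dz] and [dzbar]. *)
Definition wdiff f z : Prop := exists p q, wirtinger k f z p q.

(** The Cauchy-Riemann equation in the k-th coordinate, at the single point z. *)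
Definition wholo f z : Prop := exists p, wirtinger k f z p 0.

Lemma wdiffP f z : wdiff f z -> wirtinger k f z (dz k f z) (dzbar k f z).
Proof.
by move=> [p [q h]]; rewrite (wirtinger_dz h) (wirtinger_dzbar h).
Qed.

Lemma wdiff_near f g z : (\forall z' \near z, f z' = g z') -> wdiff f z -> wdiff g z.
Proof. by move=> fg [p [q h]]; exists p, q; exact: wirtinger_near fg h. Qed.

Lemma wdiff_cst c z : wdiff (fun=> c) z.
Proof. by exists 0, 0; exact: wirtinger_cst. Qed.

Lemma wdiffD f g z : wdiff f z -> wdiff g z -> wdiff (fun z' => f z' + g z') z.
Proof. by move=> [p [q h]] [p' [q' h']]; do 2 eexists; exact: wirtingerD h h'. Qed.

Lemma wdiffM f g z : wdiff f z -> wdiff g z -> wdiff (fun z' => f z' * g z') z.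
Proof. by move=> [p [q h]] [p' [q' h']]; do 2 eexists; exact: wirtingerM h h'. Qed.

Lemma wdiffN f z : wdiff f z -> wdiff (fun z' => - f z') z.
Proof. by move=> [p [q h]]; do 2 eexists; exact: wirtingerN h. Qed.

Lemma wdiffJ f z : wdiff f z -> wdiff (fun z' => (f z')^*) z.
Proof. by move=> [p [q h]]; do 2 eexists; exact: wirtingerJ h. Qed.

Lemma wdiffV f z : f z != 0 -> wdiff f z -> wdiff (fun z' => (f z')^-1) z.
Proof. by move=> f0 [p [q h]]; do 2 eexists; exact: wirtingerV f0 h. Qed.

Lemma wdiffX f m z : wdiff f z -> wdiff (fun z' => f z' ^+ m) z.
Proof.
move=> h; elim: m => [|m IH].
  by rewrite (_ : (fun z' => _) = fun=> 1) //; exact: wdiff_cst.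
rewrite (_ : (fun z' => _) = fun z' => f z' * f z' ^+ m); first exact: wdiffM.
by apply/funext => z'; rewrite exprS.
Qed.

Lemma wdiff_sum (I : Type) (r : seq I) (P : pred I)
    (f : I -> 'rV[Cplx R]_n -> Cplx R) z :
  (forall i, wdiff (f i) z) -> wdiff (fun z' => \sum_(i <- r | P i) f i z') z.
Proof.
by move=> h; do 2 eexists; apply: wirtinger_sum => i; exact: wdiffP (h i).
Qed.

Lemma wdiff_prod (I : Type) (r : seq I) (f : I -> 'rV[Cplx R]_n -> Cplx R) z :
  (forall i, wdiff (f i) z) -> wdiff (fun z' => \prod_(i <- r) f i z') z.
Proof.
move=> h; elim: r => [|i r IH].
  rewrite (_ : (fun z' => _) = fun=> 1); first exact: wdiff_cst.
  by apply/funext => z'; rewrite big_nil.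
rewrite (_ : (fun z' => _) = fun z' => f i z' * \prod_(i <- r) f i z').
  exact: wdiffM.
by apply/funext => z'; rewrite big_cons.
Qed.

Lemma wdiff_det m (A : 'rV[Cplx R]_n -> 'M[Cplx R]_m) z :
  (forall i j, wdiff (fun z' => A z' i j) z) -> wdiff (fun z' => \det (A z')) z.
Proof.
move=> h; rewrite /determinant; apply: wdiff_sum => s; apply: wdiffM.
  exact: wdiff_cst.
by apply: wdiff_prod => i; exact: h.
Qed.

(** By Cramer's rule the entries are rational in those of [A]. Invertibility is asked on a
    neighbourhood because [invmx] returns a singular matrix unchanged. *)
Lemma wdiff_invmx m (A : 'rV[Cplx R]_n -> 'M[Cplx R]_m) z i j :
  (\forall z' \near z, A z' \in unitmx) ->
  (forall i j, wdiff (fun z' => A z' i j) z) ->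
  wdiff (fun z' => invmx (A z') i j) z.
Proof.
move=> Au h.
apply: (@wdiff_near (fun z' => (\det (A z'))^-1 * cofactor (A z') j i)).
  by near=> z'; rewrite /invmx (near Au z') // !mxE.
apply: wdiffM.
  apply: wdiffV; last exact: wdiff_det.
  by have := nbhs_singleton Au; rewrite unitmxE unitfE.
rewrite /cofactor; apply: wdiffM; first exact: wdiff_cst.
apply: wdiff_det => i' j'.
rewrite (_ : (fun z' => _) = fun z' => A z' (lift j i') (lift i j')) //.
by apply/funext => z'; rewrite !mxE.
Unshelve. all: by end_near. Qed.

Lemma wholoD f g z : wholo f z -> wholo g z -> wholo (fun z' => f z' + g z') z.
Proof.
move=> [p h] [p' h']; exists (p + p').
by apply: wirtinger_eq (wirtingerD h h') _ _ => //; rewrite addr0.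
Qed.

Lemma wholoM f g z : wholo f z -> wholo g z -> wholo (fun z' => f z' * g z') z.
Proof.
move=> [p h] [p' h']; exists (p * g z + f z * p').
by apply: wirtinger_eq (wirtingerM h h') _ _ => //; rewrite mul0r mulr0 addr0.
Qed.

Lemma wholo_cst c z : wholo (fun=> c) z.
Proof. by exists 0; exact: wirtinger_cst. Qed.

Lemma wholo_coord l z : wholo (fun z' => z' 0 l) z.
Proof. by eexists; exact: wirtinger_coord. Qed.

Lemma wholo_sum (I : Type) (r : seq I) (P : pred I)
    (f : I -> 'rV[Cplx R]_n -> Cplx R) z :
  (forall i, wholo (f i) z) -> wholo (fun z' => \sum_(i <- r | P i) f i z') z.
Proof.
move=> h; have h' i := projT2 (cid (h i)); eexists.
by apply: wirtinger_eq (wirtinger_sum r P h') (erefl _) _; rewrite big1.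
Qed.

End WirtingerDifferentiable.

(** * Finite sums, Hermitian matrices and the quotient [dquot] *)

Lemma continuous_for_sum (R : realType) n (I : Type) (r : seq I)
    (f : I -> 'rV[Cplx R]_n -> Cplx R) z :
  (forall i, {for z, continuous (f i)}) ->
  {for z, continuous (fun z' => \sum_(i <- r) f i z')}.
Proof.
move=> h; elim: r => [|i r IH].
  rewrite (_ : (fun z' => _) = fun=> 0); first exact: cst_continuous.
  by apply/funext => z'; rewrite big_nil.
rewrite (_ : (fun z' => _) = fun z' => f i z' + \sum_(i <- r) f i z').
  exact: (cvgD (h i) IH).
by apply/funext => z'; rewrite big_cons.
Qed.

Lemma sum_delta (R : pzSemiRingType) n (f : 'I_n -> R) k :
  \sum_i f i * (i == k)%:R = f k.
Proof.
rewrite (bigD1 k) //= eqxx mulr1 big1 ?addr0 // => i /negPf ->.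
by rewrite mulr0.
Qed.

Section HermitianMatrix.
Variables (R : realType) (n : nat) (A : 'M[Cplx R]_n).
Hypothesis Apos : posdefmx A.

Lemma posdefmx_conj i j : (A i j)^* = A j i.
Proof.
have [+ _] := Apos; rewrite is_hermitianmxE expr0 scale1r => /eqP AE.
by rewrite [in RHS]AE !mxE.
Qed.

Lemma posdefmx_unit : A \in unitmx.
Proof.
have [_ Ap] := Apos; rewrite unitmxE unitfE; apply/det0P => -[v /Ap + vA].
by rewrite vA mul0mx mxE ltxx.
Qed.

End HermitianMatrix.

(* The derivative of [2 A l / (B C) - A^2 c / (B C^2)] along a vector that
   takes [A], [l], [B], [C], [c] to [A'], [l'], [B'], [C'], [c']. *)
Definition dquot (K : fieldType) (A l B C c A' l' B' C' c' : K) : K :=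
  2 * (A' * l + A * l') / (B * C) - 2 * A * l * (B' / B + C' / C) / (B * C)
  - 2 * A * A' * c / (B * C ^+ 2) - A ^+ 2 * c' / (B * C ^+ 2)
  + A ^+ 2 * c * (B' / B + 2 * C' / C) / (B * C ^+ 2).

(** [dquot] is linear in its five primed arguments, with coefficients [k1] to [k5]. It is used to
    contract fibre derivatives with eta and with the Hermitian spray, and base derivatives with
    eta. *)
Lemma dquot_sum (K : fieldType) n (A l B C c : K) (A' l' B' C' c' x : 'I_n -> K) :
  \sum_j dquot A l B C c (A' j) (l' j) (B' j) (C' j) (c' j) * x j =
  dquot A l B C c (\sum_j A' j * x j) (\sum_j l' j * x j) (\sum_j B' j * x j)
    (\sum_j C' j * x j) (\sum_j c' j * x j).
Proof.
pose k1 := 2 * l / (B * C) - 2 * A * c / (B * C ^+ 2).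
pose k2 := 2 * A / (B * C).
pose k3 := A ^+ 2 * c / B / (B * C ^+ 2) - 2 * A * l / B / (B * C).
pose k4 := 2 * A ^+ 2 * c / C / (B * C ^+ 2) - 2 * A * l / C / (B * C).
pose k5 := - A ^+ 2 / (B * C ^+ 2).
have dE A1 l1 B1 C1 c1 : dquot A l B C c A1 l1 B1 C1 c1 =
    k1 * A1 + k2 * l1 + k3 * B1 + k4 * C1 + k5 * c1.
  by rewrite /dquot /k1 /k2 /k3 /k4 /k5; ring.
rewrite dE !mulr_sumr -!big_split /=; apply: eq_bigr => j _.
by rewrite dE; ring.
Qed.

(** * Fibre derivatives of L and the fundamental tensor *)

Section Kropina.
Variables (R : realType) (n : nat).
Variables (a : 'rV[Cplx R]_n -> 'M[Cplx R]_n) (b : 'rV[Cplx R]_n -> 'rV[Cplx R]_n).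
Implicit Types z eta : 'rV[Cplx R]_n.

Definition alpha2 z eta : Cplx R := \sum_i \sum_j a z i j * eta 0 i * (eta 0 j)^*.

(** This form of l_{bar m} is visibly holomorphic in eta; for Hermitian [a] it is the conjugate of
    [l_low], see [l_low_conj]. *)
Definition l_bar (m : 'I_n) z eta : Cplx R := \sum_i a z i m * eta 0 i.

(* dL/d(bar eta^m) for L = F^2 *)
Definition L_bar (m : 'I_n) z eta : Cplx R :=
  2 * alpha2 z eta * l_bar m z eta / (beta b z eta * (beta b z eta)^*)
  - alpha2 z eta ^+ 2 * (b z 0 m)^* / (beta b z eta * (beta b z eta)^* ^+ 2).

(** Squaring removes both the root and the modulus, so the Wirtinger rules apply to L as a
    quotient. *)
Lemma kropina_sqr z eta :
  kropina a b z eta ^+ 2 = alpha2 z eta ^+ 2 / (beta b z eta * (beta b z eta)^*).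
Proof. by rewrite /kropina expr_div_n /alpha sqrtCK normCK. Qed.

Lemma alpha2_l_low z eta : alpha2 z eta = \sum_i l_low a i z eta * eta 0 i.
Proof.
apply: eq_bigr => i _; rewrite /l_low mulr_suml; apply: eq_bigr => j _.
by rewrite mulrAC.
Qed.

Section FiberDerivatives.
Variables (z eta : 'rV[Cplx R]_n) (k : 'I_n).

Lemma wirtinger_alpha2_fiber :
  wirtinger k (alpha2 z) eta (l_low a k z eta) (l_bar k z eta).
Proof.
apply: wirtinger_eq (wirtinger_sum _ _ (fun i => wirtinger_sum _ _ (fun j =>
  wirtingerM (wirtinger_coordM k (a z i j) i eta)
    (wirtingerJ (wirtinger_coord k j eta))))) _ _.
- rewrite -(sum_delta (fun i => l_low a i z eta) k); apply: eq_bigr => i _.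
  rewrite /l_low mulr_suml; apply: eq_bigr => j _; rewrite conjC0.
  ring.
- rewrite exchange_big -(sum_delta (fun i => l_bar i z eta) k).
  apply: eq_bigr => j _; rewrite /l_bar mulr_suml; apply: eq_bigr => i _.
  by rewrite conjC_nat mul0r add0r.
Qed.

Lemma wirtinger_beta_fiber : wirtinger k (beta b z) eta (b z 0 k) 0.
Proof.
apply: wirtinger_eq (wirtinger_sum _ _ (fun i =>
  wirtinger_coordM k (b z 0 i) i eta)) _ _; first exact: sum_delta.
by rewrite big1.
Qed.

Lemma wirtinger_l_bar_fiber m : wirtinger k (l_bar m z) eta (a z k m) 0.
Proof.
apply: wirtinger_eq (wirtinger_sum _ _ (fun i =>
  wirtinger_coordM k (a z i m) i eta)) _ _.
  exact: (sum_delta (fun i => a z i m)).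
by rewrite big1.
Qed.

(** Identities proved where beta is nonzero hold on a neighbourhood, hence may be differentiated in
    the fibre. *)
Lemma beta_fiber_near :
  beta b z eta != 0 -> \forall eta' \near eta, beta b z eta' != 0.
Proof.
move=> b0; apply: (@cvgr_neq0 _ _ _ (nbhs eta) _ (beta b z) (beta b z eta)) => //.
apply: (@continuous_for_sum _ _ _ _ (fun i eta' => b z 0 i * eta' 0 i)) => i.
have cb : (fun=> b z 0 i) x @[x --> eta] --> b z 0 i by exact: cst_continuous.
exact: (cvgM cb (@coord_continuous _ _ _ 0 i eta)).
Qed.

End FiberDerivatives.

(** Serves both in the fibre, where [c] is constant, and in the base, where all four functions vary.
    The role of C is played by the conjugate of [B], whose [dz] is the conjugate of [B2]. Only the
    [dz] coefficient is wanted later, so the other one stays existential. *)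
Lemma wirtinger_dquot k (A l B c : 'rV[Cplx R]_n -> Cplx R) x
    A1 A2 l1 l2 B1 B2 c1 c2 :
  B x != 0 ->
  wirtinger k A x A1 A2 -> wirtinger k l x l1 l2 -> wirtinger k B x B1 B2 ->
  wirtinger k c x c1 c2 ->
  exists q, wirtinger k (fun y => 2 * A y * l y / (B y * (B y)^*)
     - A y ^+ 2 * c y / (B y * (B y)^* ^+ 2)) x
    (dquot (A x) (l x) (B x) (B x)^* (c x) A1 l1 B1 B2^* c1) q.
Proof.
move=> B0 hA hl hB hc; have B0' : (B x)^* != 0 by rewrite conjC_eq0.
have hJ := wirtingerJ hB.
have hBB := wirtingerM hB hJ.
have h1 := wirtingerM (wirtingerM (wirtingerM (wirtinger_cst k x 2) hA) hl)
  (wirtingerV (mulf_neq0 B0 B0') hBB).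
have h2 := wirtingerM (wirtingerM (wirtingerM hA hA) hc)
  (wirtingerV (mulf_neq0 B0 (mulf_neq0 B0' B0')) (wirtingerM hB (wirtingerM hJ hJ))).
eexists; apply: wirtinger_eq (wirtingerD h1 (wirtingerN h2)) _ (erefl _).
rewrite /dquot; move: (A x) (l x) (B x) (B x)^* (c x) B2^* B0 B0' => *.
by field; apply/andP.
Qed.

Lemma dzbar_kropina_sqr m z eta : beta b z eta != 0 ->
  dzbar m (fun eta' => kropina a b z eta' ^+ 2) eta = L_bar m z eta.
Proof.
move=> B0; have B0' : (beta b z eta)^* != 0 by rewrite conjC_eq0.
have hA := wirtinger_alpha2_fiber z eta m.
have hB := wirtinger_beta_fiber z eta m.
have h := wirtingerM (wirtingerM hA hA)
  (wirtingerV (mulf_neq0 B0 B0') (wirtingerM hB (wirtingerJ hB))).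
rewrite (_ : (fun eta' => _) = fun eta' => alpha2 z eta' * alpha2 z eta'
    / (beta b z eta' * (beta b z eta')^*)); last first.
  by apply/funext => eta'; rewrite kropina_sqr expr2.
rewrite (wirtinger_dzbar h) /L_bar.
move: (alpha2 z eta) (l_bar m z eta) (beta b z eta)
  (beta b z eta)^* (b z 0 m)^* B0 B0' => *.
by field; apply/andP.
Qed.

(** Differentiate [L_bar] in eta^i. The last two arguments vanish: bar beta is antiholomorphic in
    eta, and b depends on z only. *)
Lemma fundamental_tensor_kropina i m z eta : beta b z eta != 0 ->
  fundamental_tensor (kropina a b) z eta i m =
  dquot (alpha2 z eta) (l_bar m z eta) (beta b z eta) (beta b z eta)^* (b z 0 m)^*
    (l_low a i z eta) (a z i m) (b z 0 i) 0 0.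
Proof.
move=> B0; rewrite mxE.
have hc := wirtinger_cst i eta (b z 0 m)^*.
have [q] := wirtinger_dquot B0 (wirtinger_alpha2_fiber z eta i)
  (wirtinger_l_bar_fiber z eta i m) (wirtinger_beta_fiber z eta i) hc.
rewrite conjC0 => h; apply: wirtinger_dz; apply: wirtinger_near h.
near=> eta'; apply/esym/dzbar_kropina_sqr; near: eta'; exact: beta_fiber_near.
Unshelve. all: by end_near. Qed.

(** Euler's relation: [L_bar] has degree 1 in eta when bar eta is held fixed. *)
Lemma fundamental_tensor_euler m z eta : beta b z eta != 0 ->
  \sum_l fundamental_tensor (kropina a b) z eta l m * eta 0 l = L_bar m z eta.
Proof.
move=> B0; under eq_bigr do rewrite fundamental_tensor_kropina //.
rewrite dquot_sum -alpha2_l_low.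
rewrite -[\sum_j a z j m * _]/(l_bar m z eta) -[\sum_j b z 0 j * _]/(beta b z eta).
have -> : \sum_j 0 * eta 0 j = 0 by rewrite -mulr_sumr mul0r.
have B0' : (beta b z eta)^* != 0 by rewrite conjC_eq0.
rewrite /L_bar /dquot.
move: (alpha2 z eta) (l_bar m z eta) (beta b z eta)
  (beta b z eta)^* (b z 0 m)^* B0 B0' => *.
by field; apply/andP.
Qed.

End Kropina.

(** * Base derivatives at a point z of a chart image *)

Section KropinaBase.
Variables (R : realType) (n : nat).
Variables (a : 'rV[Cplx R]_n -> 'M[Cplx R]_n) (b : 'rV[Cplx R]_n -> 'rV[Cplx R]_n).
Variable U : set 'rV[Cplx R]_n.
Hypothesis U_open : open U.
Hypothesis a_smooth : forall i j, smooth_on U (fun z => a z i j).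
Hypothesis a_posdef : forall z, U z -> posdefmx (a z).
Hypothesis b_smooth : forall i, smooth_on U (fun z => b z 0 i).
Variable z : 'rV[Cplx R]_n.
Hypothesis Uz : U z.
Implicit Types eta : 'rV[Cplx R]_n.

Let near_U : \forall z' \near z, U z'.
Proof. exact: open_nbhs_nbhs. Qed.

Lemma wirtinger_metric k i j : wirtinger k (fun z' => a z' i j) z
  (dz k (fun z' => a z' i j) z) (dzbar k (fun z' => a z' i j) z).
Proof. exact: wirtinger_smooth (a_smooth i j) Uz. Qed.

Lemma wirtinger_form k i : wirtinger k (fun z' => b z' 0 i) z
  (dz k (fun z' => b z' 0 i) z) (dzbar k (fun z' => b z' 0 i) z).
Proof. exact: wirtinger_smooth (b_smooth i) Uz. Qed.

(** The form b is smooth rather than holomorphic, so this derivative need not vanish. *)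
Lemma dz_form_conj k i :
  dz k (fun z' => (b z' 0 i)^*) z = (dzbar k (fun z' => b z' 0 i) z)^*.
Proof. exact: wirtinger_dz (wirtingerJ (wirtinger_form k i)). Qed.

Lemma beta_base_near eta :
  beta b z eta != 0 -> \forall z' \near z, beta b z' eta != 0.
Proof.
move=> B0; apply: (@cvgr_neq0 _ _ _ (nbhs z) _ (beta b ^~ eta) (beta b z eta)) => //.
apply: (@continuous_for_sum _ _ _ _ (fun i z' => b z' 0 i * eta 0 i)) => i.
have [cb _] := b_smooth i 0.
have ce : (fun=> eta 0 i) x @[x --> z] --> eta 0 i by exact: cst_continuous.
exact: (cvgM (cb z Uz) ce).
Qed.

Section BaseDerivatives.
Variables (eta : 'rV[Cplx R]_n) (k : 'I_n).

Lemma wirtinger_alpha2_base : exists q, wirtinger k (fun z' => alpha2 a z' eta) z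
  (\sum_m (\sum_i dz k (fun z' => a z' i m) z * eta 0 i) * (eta 0 m)^*) q.
Proof.
eexists; apply: wirtinger_eq (wirtinger_sum _ _ (fun i => wirtinger_sum _ _ (fun m =>
  wirtingerM (wirtingerM (wirtinger_metric k i m) (wirtinger_cst k z (eta 0 i)))
    (wirtinger_cst k z (eta 0 m)^*)))) _ (erefl _).
rewrite exchange_big; apply: eq_bigr => m _; rewrite mulr_suml.
by apply: eq_bigr => i _; rewrite !mulr0 !addr0.
Qed.

Lemma wirtinger_l_bar_base m : exists q, wirtinger k (fun z' => l_bar a m z' eta) z
  (\sum_i dz k (fun z' => a z' i m) z * eta 0 i) q.
Proof.
eexists; apply: wirtinger_eq (wirtinger_sum _ _ (fun i =>
  wirtingerM (wirtinger_metric k i m) (wirtinger_cst k z (eta 0 i)))) _ (erefl _).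
by apply: eq_bigr => i _; rewrite mulr0 addr0.
Qed.

Lemma wirtinger_beta_base : wirtinger k (fun z' => beta b z' eta) z
  (\sum_i dz k (fun z' => b z' 0 i) z * eta 0 i)
  (\sum_i dzbar k (fun z' => b z' 0 i) z * eta 0 i).
Proof.
by apply: wirtinger_eq (wirtinger_sum _ _ (fun i =>
  wirtingerM (wirtinger_form k i) (wirtinger_cst k z (eta 0 i)))) _ _;
  apply: eq_bigr => i _; rewrite mulr0 addr0.
Qed.

Lemma wirtinger_L_bar_base m : beta b z eta != 0 ->
  exists q, wirtinger k (fun z' => L_bar a b m z' eta) z
    (dquot (alpha2 a z eta) (l_bar a m z eta) (beta b z eta) (beta b z eta)^*
      (b z 0 m)^*
      (\sum_m (\sum_i dz k (fun z' => a z' i m) z * eta 0 i) * (eta 0 m)^*)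
      (\sum_i dz k (fun z' => a z' i m) z * eta 0 i)
      (\sum_i dz k (fun z' => b z' 0 i) z * eta 0 i)
      (\sum_i dz k (fun z' => (b z' 0 i)^*) z * (eta 0 i)^*)
      (dz k (fun z' => (b z' 0 m)^*) z)) q.
Proof.
move=> B0; have [q1 h1] := wirtinger_alpha2_base.
have [q2 h2] := wirtinger_l_bar_base m.
have [q h] := wirtinger_dquot (B := fun z' => beta b z' eta) B0 h1 h2 wirtinger_beta_base
  (wirtingerJ (wirtinger_form k m)).
suff -> : \sum_i dz k (fun z' => (b z' 0 i)^*) z * (eta 0 i)^* =
    (\sum_i dzbar k (fun z' => b z' 0 i) z * eta 0 i)^*.
  by exists q; rewrite dz_form_conj.
by rewrite rmorph_sum; apply: eq_bigr => i _; rewrite dz_form_conj rmorphM.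
Qed.

(** [dz] is total, so passing it through a sum requires each summand to be differentiable. Near z
    each entry is the quotient given by [fundamental_tensor_kropina]. *)
Lemma wdiff_fundamental_tensor l m : beta b z eta != 0 ->
  wdiff k (fun z' => fundamental_tensor (kropina a b) z' eta l m) z.
Proof.
move=> B0; have B0' : (beta b z eta)^* != 0 by rewrite conjC_eq0.
have hA : wdiff k (fun z' => alpha2 a z' eta) z.
  by have [q h] := wirtinger_alpha2_base; do 2 eexists; exact: h.
have hl : wdiff k (fun z' => l_bar a m z' eta) z.
  by have [q h] := wirtinger_l_bar_base m; do 2 eexists; exact: h.
have hB : wdiff k (fun z' => beta b z' eta) z.
  by do 2 eexists; exact: wirtinger_beta_base.
have hBJ := wdiffJ hB.
have hc : wdiff k (fun z' => (b z' 0 m)^*) z.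
  by apply: wdiffJ; do 2 eexists; exact: wirtinger_form.
have ha : wdiff k (fun z' => a z' l m) z.
  by do 2 eexists; exact: wirtinger_metric.
have hb : wdiff k (fun z' => b z' 0 l) z.
  by do 2 eexists; exact: wirtinger_form.
have hL : wdiff k (fun z' => l_low a l z' eta) z.
  apply: wdiff_sum => j; apply: wdiffM; last exact: wdiff_cst.
  by do 2 eexists; exact: wirtinger_metric.
apply: (@wdiff_near _ _ _ (fun z' => dquot (alpha2 a z' eta) (l_bar a m z' eta)
    (beta b z' eta) (beta b z' eta)^* (b z' 0 m)^*
    (l_low a l z' eta) (a z' l m) (b z' 0 l) 0 0)).
  near=> z'; apply/esym/fundamental_tensor_kropina.
  by near: z'; exact: beta_base_near.
rewrite /dquot.
repeat first [exact: hA | exact: hl | exact: hB | exact: hBJ | exact: hc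
  | exact: ha | exact: hb | exact: hL | exact: wdiff_cst
  | apply: wdiffD | apply: wdiffN | apply: wdiffM | apply: wdiffX | apply: wdiffV];
  by rewrite ?mulf_neq0 ?expf_neq0.
Unshelve. all: by end_near. Qed.

(** Euler's relation differentiated in z with eta fixed; it rewrites the contraction that occurs in
    [CF_connection]. *)
Lemma dz_fundamental_tensor_euler m : beta b z eta != 0 ->
  \sum_l dz k (fun z' => fundamental_tensor (kropina a b) z' eta l m) z * eta 0 l
  = dz k (fun z' => L_bar a b m z' eta) z.
Proof.
move=> B0; apply/esym/wirtinger_dz.
apply: (@wirtinger_near _ _ _ (fun z' =>
    \sum_l fundamental_tensor (kropina a b) z' eta l m * eta 0 l)).
  near=> z'; apply: fundamental_tensor_euler.
  by near: z'; exact: beta_base_near.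
apply: wirtinger_eq (wirtinger_sum _ _ (fun l => wirtingerM
  (wdiffP (wdiff_fundamental_tensor l m B0)) (wirtinger_cst k z (eta 0 l)))) _ (erefl _).
by apply: eq_bigr => l _; rewrite mulr0 addr0.
Unshelve. all: by end_near. Qed.

End BaseDerivatives.

(** * The Hermitian spray and the hypothesis expressed through it *)

(** This and the next two definitions are D l_{bar m}, D beta and D b_{bar m} with D = eta^j d/dz^j.
    At fixed z they are polynomials in eta, hence holomorphic. *)
Definition dl_bar m eta : Cplx R :=
  \sum_j (\sum_i dz j (fun z' => a z' i m) z * eta 0 i) * eta 0 j.

Definition dbeta eta : Cplx R :=
  \sum_j (\sum_i dz j (fun z' => b z' 0 i) z * eta 0 i) * eta 0 j.

Definition dform_conj m eta : Cplx R :=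
  \sum_j dz j (fun z' => (b z' 0 m)^*) z * eta 0 j.

(* Twice the spray of the Hermitian metric [a]. *)
Definition hermitian_spray eta : 'rV[Cplx R]_n :=
  (\row_m dl_bar m eta) *m invmx (a z).

Lemma hermitian_sprayE eta m :
  \sum_i hermitian_spray eta 0 i * a z i m = dl_bar m eta.
Proof.
have := mulmxKV (posdefmx_unit (a_posdef Uz)) (\row_m dl_bar m eta).
by move/matrixP/(_ 0 m); rewrite !mxE.
Qed.

(** The variation of alpha^2 along X in the fibre equals its variation along D in the base. *)
Lemma hermitian_spray_l_low eta :
  \sum_i l_low a i z eta * hermitian_spray eta 0 i =
  \sum_m dl_bar m eta * (eta 0 m)^*.
Proof.
under [RHS]eq_bigr do rewrite -hermitian_sprayE mulr_suml.
rewrite exchange_big; apply: eq_bigr => i _.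
by rewrite /l_low mulr_suml; apply: eq_bigr => m _; ring.
Qed.

Lemma b_up_conjE z' m : U z' -> \sum_i a z' m i * (b_up a b i z')^* = b z' 0 m.
Proof.
move=> Uz'; have ap := a_posdef Uz'.
have : (\row_i (b z' 0 i)^*) *m invmx (a z') *m a z' = \row_i (b z' 0 i)^*.
  exact: mulmxKV (posdefmx_unit ap) _.
move/matrixP/(_ 0 m); rewrite !mxE => /(congr1 Num.conj); rewrite conjCK => <-.
rewrite rmorph_sum; apply: eq_bigr => i _.
rewrite rmorphM /= (posdefmx_conj ap) mulrC; congr (_^* * _).
by rewrite /b_up !mxE; apply: eq_bigr => j _; rewrite !mxE mulrC.
Qed.

Lemma l_low_conj r eta : (l_low a r z eta)^* = l_bar a r z eta.
Proof.
rewrite rmorph_sum; apply: eq_bigr => j _.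
by rewrite rmorphM /= conjCK (posdefmx_conj (a_posdef Uz)).
Qed.

(** Raising and lowering the index of b. It is stated at every point of [U] because it gets
    differentiated in z. *)
Lemma beta_b_up z' eta : U z' ->
  beta b z' eta = \sum_r l_bar a r z' eta * (b_up a b r z')^*.
Proof.
move=> Uz'; under [RHS]eq_bigr do rewrite mulr_suml.
rewrite exchange_big; apply: eq_bigr => i _.
rewrite -(b_up_conjE i Uz') mulr_suml; apply: eq_bigr => r _; ring.
Qed.

Lemma wdiff_b_up k r : wdiff k (b_up a b r) z.
Proof.
apply: wdiff_sum => j; apply: wdiffM.
  apply: wdiff_invmx => [|i' j'].
    by near=> z'; apply/posdefmx_unit/a_posdef; near: z'.
  by do 2 eexists; exact: wirtinger_metric.
by apply: wdiffJ; do 2 eexists; exact: wirtinger_form.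
Unshelve. all: by end_near. Qed.

(* Differentiating [l_{bar r} b^{bar r} = beta] trades derivatives of [b^{bar r}]
   for derivatives of [beta] and of the metric. *)
Lemma l_low_dz_b_up k eta :
  \sum_r (l_low a r z eta)^* * dz k (fun z' => (b_up a b r z')^*) z =
  \sum_i dz k (fun z' => b z' 0 i) z * eta 0 i
  - \sum_r (\sum_i dz k (fun z' => a z' i r) z * eta 0 i) * (b_up a b r z)^*.
Proof.
have h := wirtinger_sum (index_enum 'I_n) xpredT (fun r =>
  wirtingerM (wdiffP (ex_intro _ _ (wirtinger_l_bar_base eta k r)))
    (wdiffP (wdiffJ (wdiff_b_up k r)))).
have near_beta : \forall z' \near z,
    \sum_r l_bar a r z' eta * (b_up a b r z')^* = beta b z' eta.
  by near=> z'; apply/esym/beta_b_up; near: z'.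
have := wirtinger_dz (wirtinger_near near_beta h).
rewrite (wirtinger_dz (wirtinger_beta_base eta k)) => ->.
rewrite -sumrB; apply: eq_bigr => r _; have [q hq] := wirtinger_l_bar_base eta k r.
by rewrite (wirtinger_dz hq) l_low_conj addrAC subrr add0r.
Unshelve. all: by end_near. Qed.

Lemma kropina_exprE eta :
  kropina_expr a b z eta =
  (beta b z eta)^* * (dbeta eta - \sum_i hermitian_spray eta 0 i * b z 0 i)
  + beta b z eta * \sum_r dform_conj r eta * (eta 0 r)^*.
Proof.
(* Insert D l_{bar r} = X^i a_{i bar r} and lower the index: a_{i bar r} b^{bar r} = b_i. *)
have -> : \sum_i hermitian_spray eta 0 i * b z 0 i =
    \sum_r dl_bar r eta * (b_up a b r z)^*.
  under [RHS]eq_bigr do rewrite -hermitian_sprayE mulr_suml.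
  rewrite exchange_big; apply: eq_bigr => i _.
  by rewrite -(b_up_conjE i Uz) mulr_sumr; apply: eq_bigr => r _; ring.
rewrite /kropina_expr.
under eq_bigr do rewrite l_low_dz_b_up mulrDl -!mulrA.
rewrite big_split /= -!mulr_sumr; congr (_ * _ + _ * _).
- transitivity (\sum_j (
      (\sum_i dz j (fun z' => b z' 0 i) z * eta 0 i) * eta 0 j
      - (\sum_r (\sum_i dz j (fun z' => a z' i r) z * eta 0 i)
          * (b_up a b r z)^*) * eta 0 j)).
    by apply: eq_bigr => j _; rewrite mulrBl.
  rewrite sumrB; congr (_ - _).
  under [RHS]eq_bigr do rewrite mulr_suml.
  rewrite exchange_big; apply: eq_bigr => j _; rewrite mulr_suml.
  by apply: eq_bigr => r _; ring.
- under eq_bigr do rewrite mulr_suml.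
  rewrite exchange_big; apply: eq_bigr => r _; rewrite /dform_conj mulr_suml.
  by apply: eq_bigr => j _; ring.
Qed.

Lemma wholo_hermitian_spray k i eta : wholo k (fun eta' => hermitian_spray eta' 0 i) eta.
Proof.
rewrite (_ : (fun eta' => _) =
    fun eta' => \sum_m dl_bar m eta' * invmx (a z) m i); last first.
  by apply/funext => eta'; rewrite mxE; apply: eq_bigr => m _; rewrite mxE.
apply: wholo_sum => m; apply: wholoM; last exact: wholo_cst.
apply: wholo_sum => j; apply: wholoM; last exact: wholo_coord.
by apply: wholo_sum => l; apply: wholoM; [exact: wholo_cst|exact: wholo_coord].
Qed.

(** * Equality of the sprays of F and of the metric *)

Hypothesis kropina0 : forall eta, beta b z eta != 0 -> kropina_expr a b z eta = 0.

(* The coefficient of [bar eta^m] in the hypothesis, extracted by d/d(bar eta^m):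
   all other factors are holomorphic in [eta]. *)
Lemma kropina_expr_coef m eta : beta b z eta != 0 ->
  (b z 0 m)^* * (dbeta eta - \sum_i hermitian_spray eta 0 i * b z 0 i)
  + beta b z eta * dform_conj m eta = 0.
Proof.
move=> B0.
have [s hs] : wholo m (fun eta' =>
    dbeta eta' - \sum_i hermitian_spray eta' 0 i * b z 0 i) eta.
  rewrite (_ : (fun eta' => _) = fun eta' =>
      dbeta eta' + (-1) * \sum_i hermitian_spray eta' 0 i * b z 0 i); last first.
    by apply/funext => eta'; rewrite mulN1r.
  apply: wholoD.
    apply: wholo_sum => j; apply: wholoM; last exact: wholo_coord.
    by apply: wholo_sum => l; apply: wholoM; [exact: wholo_cst|exact: wholo_coord].
  apply: wholoM; first exact: wholo_cst.
  apply: wholo_sum => i; apply: wholoM; last exact: wholo_cst.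
  exact: wholo_hermitian_spray.
have hQ r : wholo m (dform_conj r) eta.
  by apply: wholo_sum => j; apply: wholoM; [exact: wholo_cst|exact: wholo_coord].
have hB := wirtinger_beta_fiber b z eta m.
have h := wirtingerD (wirtingerM (wirtingerJ hB) hs)
  (wirtingerM hB (wirtinger_sum (index_enum 'I_n) xpredT (fun r =>
    wirtingerM (projT2 (cid (hQ r))) (wirtingerJ (wirtinger_coord m r eta))))).
have := wirtinger_dzbar h.
(* By [kropina_exprE] the differentiated function vanishes near eta, not just at eta, so its
   derivative is 0. *)
rewrite (wirtinger_dzbar (p := 0) (q := 0)); last first.
  apply: wirtinger_near (wirtinger_cst _ _ 0).
  near=> eta'; rewrite -kropina_exprE kropina0 //.
  by near: eta'; exact: beta_fiber_near.
rewrite mulr0 addr0 mul0r add0r => hq; rewrite [RHS]hq; congr (_ + _ * _).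
by rewrite -(sum_delta (fun r => dform_conj r eta) m); apply: eq_bigr => r _;
  rewrite conjC_nat mul0r add0r.
Unshelve. all: by end_near. Qed.

(** Both sides are values of [dquot] with the same A, l, B, C, c and, by the choice of X, the same
    A' and l'. The triple (B', C', c') is (b_i X^i, 0, 0) on the left and (D beta, v bar beta, v
    b_{bar m}) on the right. Since D beta = b_i X^i - v beta, the terms in v cancel. *)
Lemma hermitian_spray_fundamental m eta : beta b z eta != 0 ->
  \sum_i fundamental_tensor (kropina a b) z eta i m * hermitian_spray eta 0 i =
  \sum_j dz j (fun z' => L_bar a b m z' eta) z * eta 0 j.
Proof.
move=> B0; have B0' : (beta b z eta)^* != 0 by rewrite conjC_eq0.
under eq_bigr do rewrite fundamental_tensor_kropina //.
rewrite dquot_sum.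
have -> : \sum_j 0 * hermitian_spray eta 0 j = 0 by rewrite -mulr_sumr mul0r.
have dzL j := wirtinger_dz (projT2 (cid (wirtinger_L_bar_base j m B0))).
have -> : \sum_j dz j (fun z' => L_bar a b m z' eta) z * eta 0 j =
    dquot (alpha2 a z eta) (l_bar a m z eta) (beta b z eta) (beta b z eta)^*
      (b z 0 m)^* (\sum_r dl_bar r eta * (eta 0 r)^*) (dl_bar m eta) (dbeta eta)
      (\sum_r dform_conj r eta * (eta 0 r)^*) (dform_conj m eta).
  under eq_bigr do rewrite dzL.
  rewrite dquot_sum; congr dquot; under eq_bigr do rewrite mulr_suml;
    rewrite exchange_big; apply: eq_bigr => r _; rewrite mulr_suml;
    by apply: eq_bigr => j _; rewrite mulrAC.
rewrite hermitian_spray_l_low.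
have -> : \sum_j a z j m * hermitian_spray eta 0 j = dl_bar m eta.
  by rewrite -hermitian_sprayE; apply: eq_bigr => j _; rewrite mulrC.
have -> : \sum_j b z 0 j * hermitian_spray eta 0 j =
    \sum_j hermitian_spray eta 0 j * b z 0 j.
  by apply: eq_bigr => j _; rewrite mulrC.
set X := \sum_j _ * b z 0 j.
(* Here [X] is the scalar b_i X^i, and the quotient by beta is v. Contracting with bar eta^r then
   gives D bar beta = v bar beta. *)
have dform_conjE r :
    dform_conj r eta = (b z 0 r)^* * ((X - dbeta eta) / beta b z eta).
  apply: (mulfI B0); rewrite -(addr0_eq (kropina_expr_coef r B0)) -/X.
  by move: (b z 0 r)^* (dbeta eta) X B0 => *; field.
have -> : \sum_r dform_conj r eta * (eta 0 r)^* =
    (beta b z eta)^* * ((X - dbeta eta) / beta b z eta).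
  rewrite rmorph_sum mulr_suml; apply: eq_bigr => r _.
  by rewrite dform_conjE rmorphM mulrAC.
rewrite {}dform_conjE /dquot.
move: (alpha2 a z eta) (l_bar a m z eta) (beta b z eta) (beta b z eta)^* (b z 0 m)^*
  (dl_bar m eta) X (dbeta eta) (\sum_m _) B0 B0' => *.
by field; apply/andP.
Qed.

(** By the differentiated Euler relation, twice the spray of F is the inverse of g applied to D
    [L_bar]; the preceding lemma shows that X solves the same linear system. *)
Lemma spray_kropina i eta : beta b z eta != 0 ->
  fundamental_tensor (kropina a b) z eta \in unitmx ->
  spray (kropina a b) i z eta = 2^-1 * hermitian_spray eta 0 i.
Proof.
move=> B0 gu; rewrite /spray; congr (_ * _).
have -> : hermitian_spray eta =
    (\row_m \sum_j dz j (fun z' => L_bar a b m z' eta) z * eta 0 j)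
    *m invmx (fundamental_tensor (kropina a b) z eta).
  rewrite -[LHS](mulmxK gu); congr (_ *m _); apply/rowP => m.
  rewrite !mxE -hermitian_spray_fundamental //.
  by apply: eq_bigr => l _; rewrite mulrC.
rewrite mxE; under [RHS]eq_bigr do rewrite mxE mulr_suml.
rewrite exchange_big; apply: eq_bigr => j _.
rewrite /CF_connection mulr_suml; apply: eq_bigr => m _.
rewrite -dz_fundamental_tensor_euler // !mulr_suml; apply: eq_bigr => l _.
ring.
Qed.

(** Chern connection coefficients of the metric; the metric need not be Kähler, so they need not be
    symmetric in [j] and [l]. *)
Definition spray_coef i j l : Cplx R :=
  \sum_m dz j (fun z' => a z' l m) z * invmx (a z) m i.

Lemma hermitian_spray_coef i eta :
  hermitian_spray eta 0 i = \sum_j \sum_l spray_coef i j l * eta 0 l * eta 0 j.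
Proof.
rewrite mxE; under eq_bigr do rewrite mxE mulr_suml.
rewrite exchange_big; apply: eq_bigr => j _.
under eq_bigr do rewrite !mulr_suml.
rewrite exchange_big; apply: eq_bigr => l _.
by rewrite /spray_coef !mulr_suml; apply: eq_bigr => m _; ring.
Qed.

End KropinaBase.

(** * Berwald coefficients *)

Lemma wirtinger_quadratic (R : realType) n (C : 'I_n -> 'I_n -> Cplx R) k eta :
  wirtinger k (fun eta' => \sum_j \sum_l C j l * eta' 0 l * eta' 0 j) eta
    (\sum_l (C k l + C l k) * eta 0 l) 0.
Proof.
apply: wirtinger_eq (wirtinger_sum _ _ (fun j => wirtinger_sum _ _ (fun l =>
  wirtingerM (wirtinger_coordM k (C j l) l eta) (wirtinger_coord k j eta)))) _ _.
- transitivity (\sum_j (\sum_l C j l * eta 0 l) * (j == k)%:R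
      + \sum_j \sum_l C j l * eta 0 j * (l == k)%:R).
    rewrite -big_split; apply: eq_bigr => j _; rewrite mulr_suml -big_split.
    by apply: eq_bigr => l _ /=; ring.
  rewrite sum_delta -big_split; apply: eq_bigr => j _.
  by rewrite sum_delta mulrDl.
- by apply: big1 => j _; apply: big1 => l _; rewrite mul0r mulr0 addr0.
Qed.

Theorem theorem4p4 (R : realType) (n : nat) (M : complexManifold R n)
    (K : kropinaSpace M)
    (M_connected : connected [set: M])
    (HK : forall c : chart R n M, atlas c ->
       forall z, chart_im c z -> forall eta, beta (kform K c) z eta != 0 ->
       kropina_expr (kmetric K c) (kform K c) z eta = 0) :
  generalized_berwald K.
Proof.
move=> c cM.
pose a := kmetric K c; pose b := kform K c.
pose C z i j l := spray_coef a z i j l.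
(* The Hessian in eta of half the quadratic form with coefficients [C z i] symmetrises them. *)
exists (fun i j k z => 2^-1 * (C z i j k + C z i k j)) => z Uz eta B0 i j k.
have sprayE eta' : beta b z eta' != 0 ->
    spray (kropina a b) i z eta' =
    2^-1 * \sum_j \sum_l C z i j l * eta' 0 l * eta' 0 j.
  move=> B0'; rewrite -hermitian_spray_coef.
  have gu : fundamental_tensor (kropina a b) z eta' \in unitmx.
    exact/posdefmx_unit/(kropina_posdef cM Uz).
  exact: (spray_kropina (@chart_im_open _ _ _ c) (metric_smooth (kmetric K) cM)
    (metric_posdef (kmetric K) cM) (form_smooth (kform K) cM) Uz
    (HK c cM z Uz) i B0' gu).
(* Stated for every eta' with beta nonzero, since the formula is differentiated once more near
   eta. *)
have dspray eta' : beta b z eta' != 0 ->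
    dz j (spray (kropina a b) i z) eta' =
    2^-1 * \sum_l (C z i j l + C z i l j) * eta' 0 l.
  move=> B0'.
  apply: wirtinger_dz.
  apply: wirtinger_near (wirtingerZ 2^-1 (wirtinger_quadratic (C z i) j eta')).
  by near=> x; apply/esym/sprayE; near: x; exact: beta_fiber_near.
rewrite /berwald_coef -(sum_delta (fun l => C z i j l + C z i l j) k).
apply: wirtinger_dz; apply: wirtinger_near (wirtingerZ 2^-1
  (wirtinger_sum (index_enum 'I_n) xpredT (fun l =>
    wirtinger_coordM k (C z i j l + C z i l j) l eta))).
by near=> x; apply/esym/dspray; near: x; exact: beta_fiber_near.
Unshelve. all: by end_near. Qed.
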